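(* Let $\mathbf p,\mathbf a\in\mathcal L$ be linearly independent and let $\mathbf\Gamma\in\mathbb R^3\setminus\{\mathbf 0\}$ with $\mathbf p\cdot\mathbf\Gamma=0$. Assume that the vectors $\mathbf\Gamma,\mathbf p,\mathbf a$ are linearly dependent. Then the operator $\mathcal M$ of the corresponding class in the linearised Euler equations is nilpotent, and $\exp(\mathcal Mt)$ is unbounded (as $t$ ranges over $[0,\infty)$).
   Context: Let $\kappa_x,\kappa_y,\kappa_z>0$ and $\mathcal L=\kappa_x\mathbb Z\times\kappa_y\mathbb Z\times\kappa_z\mathbb Z$ be the wavenumber lattice of the torus $[0,2\pi/\kappa_x)\times[0,2\pi/\kappa_y)\times[0,2\pi/\kappa_z)$. The linearisation of the three-dimensional incompressible Euler equations (in vorticity form) about the steady state $\Omega^*=2\mathbf\Gamma\cos(\mathbf p\cdot\mathbf x)$ decouples into classes, the class led by $\mathbf a$ consisting of the vorticity Fourier modes with wavenumbers $\mathbf a+n\mathbf p$, $n\in\mathbb Z$. Set $$\tilde a_x=\frac{\mathbf a\cdot\mathbf p}{|\mathbf p|^2},\quad \tilde a_y=\frac{|\mathbf a\times\mathbf p|}{|\mathbf p|^2},\quad \alpha_n=\sqrt{(\tilde a_x+n)^2+\tilde a_y^2},\quad \cos\theta=\frac{(\mathbf\Gamma\cdot\mathbf a)|\mathbf p|}{|\mathbf\Gamma||\mathbf p\times\mathbf a|},\quad \sin\theta=\frac{\mathbf\Gamma\cdot(\mathbf p\times\mathbf a)}{|\mathbf\Gamma||\mathbf p\times\mathbf a|}.$$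 After restriction to the divergence-free subspace (two scalar components, $y$ and $z$, per mode) and in suitable orthonormal coordinates, the class dynamics is $\dot{\tilde{\boldsymbol\mu}}=|\mathbf\Gamma|\,\tilde a_y\,\mathcal M\tilde{\boldsymbol\mu}$ on $\ell^2(\mathbb Z)\oplus\ell^2(\mathbb Z)$, where $\mathcal M$ is the bounded operator $$\mathcal M=\begin{pmatrix}M_1&0\\0&M_2\end{pmatrix}\sin\theta+\begin{pmatrix}0&M_3\\0&0\end{pmatrix}\cos\theta,$$ and $M_1,M_2,M_3$ are the bi-infinite matrices whose only nonzero entries are, for $n\in\mathbb Z$, $$(M_1)_{n,n\pm1}=\pm\frac{\alpha_n}{\alpha_{n\pm1}},\qquad (M_2)_{n,n\pm1}=\pm\frac{\alpha_{n\pm1}^2-1}{\alpha_{n\pm1}^2},\qquad (M_3)_{n,n\pm1}=\frac{\alpha_n}{\alpha_{n\pm1}^2}.$$ *)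

(* Defs.v *)
From HB Require Import structures.
From mathcomp Require Import all_boot all_order all_algebra.
From mathcomp Require Import finmap complex.
From mathcomp Require Import all_classical all_reals all_analysis.
From mathcomp Require Import ring lra zify.

Set Implicit Arguments.
Unset Strict Implicit.
Unset Printing Implicit Defensive.

Import Order.TTheory GRing.Theory Num.Theory.
Import Normc.

Local Open Scope classical_set_scope.
Local Open Scope ring_scope.
Local Open Scope complex_scope.

Section SquareSummable.
Variables (R : realType) (I : choiceType).
Implicit Types x y : I -> R[i].

Definition sqsum x : \bar R := \esum_(i in [set: I]) (normc (x i) ^+ 2)%:E.

Lemma normc_ge0 (z : R[i]) : 0 <= normc z.
Proof. by case: z => a b; exact: sqrtr_ge0. Qed.

Lemma sqsum_ge0 x : (0 <= sqsum x)%E.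
Proof. by apply: esum_ge0 => i _; rewrite lee_fin sqr_ge0. Qed.

Lemma esumZ_le (k : R) (a : I -> R) : 0 <= k -> (forall i, 0 <= a i) ->
  (\esum_(i in [set: I]) (k * a i)%:E <= k%:E * \esum_(i in [set: I]) (a i)%:E)%E.
Proof.
move=> k0 a0; apply: ge_ereal_sup => _ [X [finX _]] <-.
under eq_fsbigr do rewrite EFinM.
rewrite -ge0_mule_fsumr; first last.
  by move=> i; rewrite lee_fin.
apply: lee_wpmul2l; first by rewrite lee_fin.
by apply: esum_ge; exists X.
Qed.

Lemma sqsum_lin (u v : R) x y z : 0 <= u -> 0 <= v ->
  (forall i, normc (z i) ^+ 2 <= u * normc (x i) ^+ 2 + v * normc (y i) ^+ 2) ->
  (sqsum z <= u%:E * sqsum x + v%:E * sqsum y)%E.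
Proof.
move=> u0 v0 zxy.
apply: (@le_trans _ _ (\esum_(i in [set: I])
   ((u * normc (x i) ^+ 2)%:E + (v * normc (y i) ^+ 2)%:E)%E)).
  by apply: le_esum => i _; rewrite -EFinD lee_fin.
rewrite esumD; first last.
- by move=> i _; rewrite lee_fin mulr_ge0 ?sqr_ge0.
- by move=> i _; rewrite lee_fin mulr_ge0 ?sqr_ge0.
by rewrite leeD// esumZ_le// => i; rewrite sqr_ge0.
Qed.

Definition sqsummable : {pred I -> R[i]} := mem [set x | (sqsum x < +oo)%E].

Lemma sqsummableP x : reflect (sqsum x < +oo)%E (x \in sqsummable).
Proof. by apply: (iffP idP); rewrite inE. Qed.

Lemma sqsum_fin x : x \in sqsummable -> sqsum x = (fine (sqsum x))%:E.
Proof. by move=> /sqsummableP sx; rewrite fineK// ge0_fin_numE// sqsum_ge0. Qed.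

Lemma sqsummable_lin (u v : R) x y z : 0 <= u -> 0 <= v ->
  (forall i, normc (z i) ^+ 2 <= u * normc (x i) ^+ 2 + v * normc (y i) ^+ 2) ->
  x \in sqsummable -> y \in sqsummable ->
  z \in sqsummable /\
  fine (sqsum z) <= u * fine (sqsum x) + v * fine (sqsum y).
Proof.
move=> u0 v0 zxy sx sy; have := sqsum_lin u0 v0 zxy.
rewrite (sqsum_fin sx) (sqsum_fin sy) => le.
have sz : z \in sqsummable by apply/sqsummableP/(le_lt_trans le); rewrite ltry.
by split=> //; move: le; rewrite {1}(sqsum_fin sz) -lee_fin.
Qed.

Lemma sqrD_le (s a b : R) : 0 < s ->
  (a + b) ^+ 2 <= (1 + s) * a ^+ 2 + (1 + s^-1) * b ^+ 2.
Proof.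
move=> s0; rewrite -subr_ge0.
rewrite (_ : _ - _ = s^-1 * (s * a - b) ^+ 2); last by field; rewrite gt_eqF.
by rewrite mulr_ge0 ?sqr_ge0// invr_ge0 ltW.
Qed.

Lemma normcD_le (s : R) (a b : R[i]) : 0 < s ->
  normc (a + b) ^+ 2 <= (1 + s) * normc a ^+ 2 + (1 + s^-1) * normc b ^+ 2.
Proof.
move=> s0; apply: le_trans (sqrD_le _ _ s0).
by rewrite lerXn2r ?nnegrE ?addr_ge0 ?normc_ge0// le_normcD.
Qed.

Lemma sqsummable_submod : submod_closed sqsummable.
Proof.
split.
  apply/sqsummableP; rewrite /sqsum esum1 ?ltry// => i _.
  by rewrite (_ : GRing.zero i = 0) // normc0 expr0n.
move=> c x y sx sy.
have u0 : 0 <= (1 + 1) * normc c ^+ 2 by rewrite mulr_ge0 ?sqr_ge0.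
have v0 : 0 <= 1 + 1^-1 :> R by rewrite invr1.
have cxy i : normc ((c *: x + y) i) ^+ 2 <=
    (1 + 1) * normc c ^+ 2 * normc (x i) ^+ 2 + (1 + 1^-1) * normc (y i) ^+ 2.
  apply: le_trans (normcD_le _ _ ltr01) _.
  by rewrite normcM exprMn mulrA.
by have [] := sqsummable_lin u0 v0 cxy sx sy.
Qed.

HB.instance Definition _ :=
  GRing.isSubmodClosed.Build _ _ sqsummable sqsummable_submod.

(* the complex Hilbert space l^2(I) *)
Record ell2 : Type :=
  Ell2 { ell2_val :> I -> R[i]; ell2P : ell2_val \in sqsummable }.

HB.instance Definition _ := [isSub for ell2_val].
HB.instance Definition _ := [Choice of ell2 by <:].
HB.instance Definition _ := [SubChoice_isSubLmodule of ell2 by <:].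

Definition ell2norm (x : ell2) : R := Num.sqrt (fine (sqsum x)).

Lemma ell2norm_ge0 (x : ell2) : 0 <= ell2norm x.
Proof. exact: sqrtr_ge0. Qed.

Lemma ell2norm_sqr (x : ell2) : ell2norm x ^+ 2 = fine (sqsum x).
Proof. by rewrite sqr_sqrtr// fine_ge0// sqsum_ge0. Qed.

Lemma ell2norm_eq0 (x : ell2) : ell2norm x = 0 -> x = 0.
Proof.
move=> x0; apply/val_inj/funext => i /=.
have : sqsum x = 0%E by rewrite (sqsum_fin (ell2P x)) -ell2norm_sqr x0 expr0n.
move=> sx; apply: eq0_normc; apply/eqP.
suff : normc (x i) ^+ 2 == 0 by rewrite expf_eq0.
rewrite eq_le sqr_ge0 andbT -lee_fin -[leRHS]sx.
by apply: esum_ge; exists [set i]; rewrite ?fsbig_set1.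
Qed.

Lemma ell2normD_le (s : R) (x y : ell2) : 0 < s ->
  ell2norm (x + y) ^+ 2 <=
  (1 + s) * ell2norm x ^+ 2 + (1 + s^-1) * ell2norm y ^+ 2.
Proof.
move=> s0; rewrite !ell2norm_sqr.
have u0 : 0 <= 1 + s by rewrite addr_ge0 ?ltW.
have v0 : 0 <= 1 + s^-1 by rewrite addr_ge0 ?invr_ge0 ?ltW.
have xyP i : normc ((x + y) i) ^+ 2 <=
    (1 + s) * normc (x i) ^+ 2 + (1 + s^-1) * normc (y i) ^+ 2.
  exact: normcD_le.
by have [] := sqsummable_lin u0 v0 xyP (ell2P x) (ell2P y).
Qed.

Lemma ell2normD (x y : ell2) : ell2norm (x + y) <= ell2norm x + ell2norm y.
Proof.
have [x0|x0] := eqVneq (ell2norm x) 0.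
  by rewrite (ell2norm_eq0 x0) add0r lerDr ell2norm_ge0.
have [y0|y0] := eqVneq (ell2norm y) 0.
  by rewrite (ell2norm_eq0 y0) addr0 lerDl ell2norm_ge0.
have xp : 0 < ell2norm x by rewrite lt_neqAle eq_sym x0 ell2norm_ge0.
have yp : 0 < ell2norm y by rewrite lt_neqAle eq_sym y0 ell2norm_ge0.
have := @ell2normD_le (ell2norm y / ell2norm x) x y (divr_gt0 yp xp).
rewrite (_ : _ + _ = (ell2norm x + ell2norm y) ^+ 2); last first.
  by field; rewrite x0 y0.
by rewrite ler_pXn2r ?nnegrE ?addr_ge0 ?ell2norm_ge0.
Qed.

Lemma ell2normZ_le (c : R[i]) (x : ell2) :
  ell2norm (c *: x) <= normc c * ell2norm x.
Proof.
suff: ell2norm (c *: x) ^+ 2 <= (normc c * ell2norm x) ^+ 2.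
  by rewrite ler_pXn2r ?nnegrE ?mulr_ge0 ?ell2norm_ge0 ?normc_ge0.
rewrite exprMn !ell2norm_sqr.
have xP i : normc ((c *: x) i) ^+ 2 <=
    normc c ^+ 2 * normc (x i) ^+ 2 + 0 * normc (x i) ^+ 2.
  by rewrite mul0r addr0 -exprMn -normcM.
have [_] := sqsummable_lin (sqr_ge0 _) (lexx 0) xP (ell2P x) (ell2P x).
by rewrite mul0r addr0.
Qed.

Lemma ell2normZ (c : R[i]) (x : ell2) :
  ell2norm (c *: x) = normc c * ell2norm x.
Proof.
apply/eqP; rewrite eq_le ell2normZ_le/=.
have [->|c0] := eqVneq c 0; first by rewrite normc0 mul0r ell2norm_ge0.
have nc : 0 < normc c.
  by rewrite lt_neqAle normc_ge0 andbT eq_sym; apply: contra c0 => /eqP/eq0_normc->.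
rewrite -ler_pdivlMl// -normcV.
by apply: le_trans (ell2normZ_le _ _); rewrite scalerA mulVf// scale1r.
Qed.

(* a norm on an R[i]-module takes its values in R[i], hence the injection *)
Let ell2C_D (x y : ell2) :
  (ell2norm (x + y))%:C <= (ell2norm x)%:C + (ell2norm y)%:C.
Proof. by rewrite -rmorphD lecR ell2normD. Qed.

Let ell2C_Z (c : R[i]) (x : ell2) :
  (ell2norm (c *: x))%:C = `|c| * (ell2norm x)%:C.
Proof.
rewrite ell2normZ rmorphM; congr (_ * _).
Qed.

Let ell2C_0 (x : ell2) : (ell2norm x)%:C = 0 -> x = 0.
Proof. by move=> [] /ell2norm_eq0. Qed.

HB.instance Definition _ :=
  Lmodule_isNormed.Build R[i] ell2 ell2C_D ell2C_Z ell2C_0.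

End SquareSummable.
Arguments ell2 : clear implicits.

Section NormedModules.
Variable R : realType.

(* the R[i]-valued norm of a complex normed module, read in R *)
Definition rnorm (V : normedModType R[i]) (x : V) : R := complex.Re `|x|.

Section Rnorm.
Variable V : normedModType R[i].
Implicit Types x y : V.

Lemma rnormE x : `|x| = (rnorm x)%:C.
Proof. by rewrite /rnorm RRe_real// normr_real. Qed.

Lemma rnorm_ge0 x : 0 <= rnorm x.
Proof. by rewrite -ler0c -rnormE. Qed.

Lemma rnormD x y : rnorm (x + y) <= rnorm x + rnorm y.
Proof. by have := ler_normD x y; rewrite !rnormE -rmorphD lecR. Qed.

Lemma rnormZ (c : R[i]) x : rnorm (c *: x) = normc c * rnorm x.
Proof. by have := normrZ c x; rewrite !rnormE -[ `|c| ]/((normc c)%:C) -rmorphM => -[]. Qed.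

Lemma rnorm_eq0 x : rnorm x = 0 -> x = 0.
Proof. by move=> x0; apply/normr0_eq0; rewrite rnormE x0. Qed.

Lemma rnorm0 : rnorm (0 : V) = 0.
Proof. by apply: complexI; rewrite -rnormE normr0. Qed.

End Rnorm.

(* the Hilbert direct sum; the library's norm on pairs is the maximum norm *)
Section HilbertSum.
Variables V W : normedModType R[i].

Definition hsum : Type := (V * W)%type.

HB.instance Definition _ := GRing.Lmodule.copy hsum (V * W)%type.

Definition hsum_norm (x : hsum) : R[i] :=
  (Num.sqrt (rnorm x.1 ^+ 2 + rnorm x.2 ^+ 2))%:C.

Let hsum_normE (x : hsum) : hsum_norm x = `|rnorm x.1 +i* rnorm x.2|.
Proof. by rewrite normc_def. Qed.

Let hsum_normD (x y : hsum) :
  hsum_norm (x + y) <= hsum_norm x + hsum_norm y.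
Proof.
rewrite (hsum_normE x) (hsum_normE y).
apply: le_trans (ler_normD _ _); rewrite normc_def /hsum_norm lecR /=.
rewrite ler_wsqrtr// lerD// lerXn2r ?nnegrE ?addr_ge0 ?rnorm_ge0//.
all: exact: rnormD.
Qed.

Let hsum_normZ (c : R[i]) (x : hsum) :
  hsum_norm (c *: x) = `|c| * hsum_norm x.
Proof.
rewrite /hsum_norm !rnormZ !exprMn -mulrDr sqrtrM ?sqr_ge0// sqrtr_sqr.
by rewrite ger0_norm ?normc_ge0// rmorphM.
Qed.

Let hsum_norm_eq0 (x : hsum) : hsum_norm x = 0 -> x = 0.
Proof.
rewrite hsum_normE => /normr0_eq0 [] /rnorm_eq0 x1 /rnorm_eq0 x2.
by case: x x1 x2 => x1 x2 /= -> ->.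
Qed.

HB.instance Definition _ :=
  Lmodule_isNormed.Build R[i] hsum hsum_normD hsum_normZ hsum_norm_eq0.

End HilbertSum.

Section BoundedOperators.
Variable V : normedModType R[i].
Implicit Types f g : V -> V.

Definition bounded_linear : {pred V -> V} :=
  mem [set f | linear f /\ exists c : R, forall x, rnorm (f x) <= c * rnorm x].

Lemma bounded_linearP f : reflect
  (linear f /\ exists c : R, forall x, rnorm (f x) <= c * rnorm x)
  (f \in bounded_linear).
Proof. by apply: (iffP idP); rewrite inE. Qed.

Lemma bounded_linear_submod : submod_closed bounded_linear.
Proof.
split.
  apply/bounded_linearP; split=> [a u v|].
    by rewrite /= scaler0 addr0.
  by exists 0 => x; rewrite mul0r rnorm0.
move=> a f g /bounded_linearP[lf [c fc]] /bounded_linearP[lg [d gd]].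
apply/bounded_linearP; split=> [b u v|].
  rewrite [LHS]/(a *: f _ + g _) lf lg !scalerDr !scalerA addrACA.
  by rewrite (mulrC a b).
exists (normc a * c + d) => x; apply: le_trans (rnormD _ _) _.
rewrite mulrDl lerD// rnormZ -mulrA ler_wpM2l// normc_ge0//.
Qed.

HB.instance Definition _ :=
  GRing.isSubmodClosed.Build _ _ bounded_linear bounded_linear_submod.

Record bop : Type :=
  Bop { bop_val :> V -> V; bopP : bop_val \in bounded_linear }.

HB.instance Definition _ := [isSub for bop_val].
HB.instance Definition _ := [Choice of bop by <:].
HB.instance Definition _ := [SubChoice_isSubLmodule of bop by <:].

Lemma bop_linear (A : bop) : linear A.
Proof. by have /bounded_linearP[] := bopP A. Qed.

Lemma bop0 (A : bop) : A 0 = 0.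
Proof.
by have := bop_linear A (-1) 0 0; rewrite scaler0 addr0 scaleN1r addNr.
Qed.

Lemma bopZ (A : bop) c x : A (c *: x) = c *: A x.
Proof. by have := bop_linear A c x 0; rewrite bop0 !addr0. Qed.

Lemma bop_bounded (A : bop) :
  exists2 c : R, 0 <= c & forall x, rnorm (A x) <= c * rnorm x.
Proof.
have /bounded_linearP[_ [c Ac]] := bopP A; exists `|c| => // x.
by apply: le_trans (Ac x) _; rewrite ler_wpM2r ?rnorm_ge0// ler_norm.
Qed.

Lemma bop_ext (A B : bop) : (forall x, A x = B x) -> A = B.
Proof. by move=> AB; apply/val_inj/funext. Qed.

Lemma id_bounded_linear : idfun \in bounded_linear.
Proof.
by apply/bounded_linearP; split=> //; exists 1 => x; rewrite mul1r.
Qed.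

Lemma comp_bounded_linear (A B : bop) : (A \o B) \in bounded_linear.
Proof.
apply/bounded_linearP; split=> [a u v|]; first by rewrite /= !bop_linear.
have [c c0 Ac] := bop_bounded A; have [d d0 Bd] := bop_bounded B.
exists (c * d) => x /=; apply: le_trans (Ac _) _.
by rewrite -mulrA ler_wpM2l.
Qed.

Definition bop_one : bop := Bop id_bounded_linear.
Definition bop_mul (A B : bop) : bop := Bop (comp_bounded_linear A B).

Let bop_mulA : associative bop_mul.
Proof. by move=> A B C; exact: bop_ext. Qed.
Let bop_mul1 : left_id bop_one bop_mul.
Proof. by move=> A; exact: bop_ext. Qed.
Let bop_mulr1 : right_id bop_one bop_mul.
Proof. by move=> A; exact: bop_ext. Qed.
Let bop_mulDl : left_distributive bop_mul +%R.
Proof. by move=> A B C; exact: bop_ext. Qed.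
Let bop_mulDr : right_distributive bop_mul +%R.
Proof.
move=> A B C; apply: bop_ext => x /=.
by have := bop_linear A 1 (B x) (C x); rewrite !scale1r.
Qed.

HB.instance Definition _ := GRing.Zmodule_isPzRing.Build bop
  bop_mulA bop_mul1 bop_mulr1 bop_mulDl bop_mulDr.

Definition opnorm (A : bop) : R := sup [set rnorm (A x) | x in [set x | rnorm x <= 1]].

Lemma opnorm_has_sup (A : bop) :
  has_sup [set rnorm (A x) | x in [set x | rnorm x <= 1]].
Proof.
split; first by exists (rnorm (A 0)), 0 => //=; rewrite rnorm0.
have [c c0 Ac] := bop_bounded A; exists c => _ [x /= x1 <-].
by apply: le_trans (Ac x) _; rewrite ler_piMr.
Qed.

Lemma opnorm_unit (A : bop) x : rnorm x <= 1 -> rnorm (A x) <= opnorm A.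
Proof.
by move=> x1; apply: sup_upper_bound; [exact: opnorm_has_sup | exists x].
Qed.

Lemma opnorm_le (A : bop) (c : R) :
  (forall x, rnorm x <= 1 -> rnorm (A x) <= c) -> opnorm A <= c.
Proof.
move=> Ac; apply: ge_sup; first by have [] := opnorm_has_sup A.
by move=> _ [x x1 <-]; exact: Ac.
Qed.

Lemma opnorm_ge0 (A : bop) : 0 <= opnorm A.
Proof.
by apply: le_trans (rnorm_ge0 _) (@opnorm_unit A 0 _); rewrite rnorm0.
Qed.

Lemma opnormP (A : bop) x : rnorm (A x) <= opnorm A * rnorm x.
Proof.
have [x0|x0] := eqVneq (rnorm x) 0.
  by rewrite (rnorm_eq0 x0) bop0 !rnorm0 mulr0.
have xp : 0 < rnorm x by rewrite lt_neqAle eq_sym x0 rnorm_ge0.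
have nV : normc (rnorm x)^-1%:C = (rnorm x)^-1.
  by rewrite /= expr0n/= addr0 sqrtr_sqr ger0_norm// invr_ge0 ltW.
rewrite -ler_pdivrMr// mulrC -nV -rnormZ -bopZ opnorm_unit//.
by rewrite rnormZ nV mulVf.
Qed.

Let opnormD (A B : bop) : (opnorm (A + B))%:C <= (opnorm A)%:C + (opnorm B)%:C.
Proof.
rewrite -rmorphD lecR; apply: opnorm_le => x x1.
by apply: le_trans (rnormD _ _) _; rewrite lerD ?opnorm_unit.
Qed.

Let opnormZ_le (c : R[i]) (A : bop) : opnorm (c *: A) <= normc c * opnorm A.
Proof.
apply: opnorm_le => x x1.
by rewrite [X in rnorm X]/(c *: A x) rnormZ ler_wpM2l ?normc_ge0 ?opnorm_unit.
Qed.

Let opnormZ (c : R[i]) (A : bop) : (opnorm (c *: A))%:C = `|c| * (opnorm A)%:C.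
Proof.
rewrite (_ : `|c| = (normc c)%:C)// -rmorphM; congr (_%:C).
apply/eqP; rewrite eq_le opnormZ_le/=.
have [->|c0] := eqVneq c 0; first by rewrite normc0 mul0r opnorm_ge0.
have nc : 0 < normc c.
  by rewrite lt_neqAle normc_ge0 andbT eq_sym; apply: contra c0 => /eqP/eq0_normc->.
rewrite -ler_pdivlMl// -normcV.
by apply: le_trans (opnormZ_le _ _); rewrite scalerA mulVf// scale1r.
Qed.

Let opnorm_eq0 (A : bop) : (opnorm A)%:C = 0 -> A = 0.
Proof.
move=> [] A0; apply: bop_ext => x; apply: rnorm_eq0; apply/eqP.
by rewrite eq_le rnorm_ge0 andbT; have := opnormP A x; rewrite A0 mul0r.
Qed.

HB.instance Definition _ :=
  Lmodule_isNormed.Build R[i] bop opnormD opnormZ opnorm_eq0.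

(* bop V carries the operator norm, so this is the norm limit of the
   partial sums of the exponential series *)
Definition opexp (A : bop) : bop :=
  limn (series (fun k : nat => (k`!%:R)^-1 *: A ^+ k)).

Definition nilpotent_op (A : bop) : Prop := exists k : nat, A ^+ k = 0.

End BoundedOperators.
End NormedModules.

Section BlockOperators.
Variables (R : realType) (V : normedModType R[i]).

Lemma hsum_fst_le (x : hsum V V) : rnorm x.1 <= rnorm x.
Proof.
rewrite [leRHS]/(Num.sqrt (rnorm x.1 ^+ 2 + rnorm x.2 ^+ 2)).
by rewrite -{1}(ger0_norm (rnorm_ge0 x.1)) -sqrtr_sqr ler_wsqrtr// lerDl sqr_ge0.
Qed.

Lemma hsum_snd_le (x : hsum V V) : rnorm x.2 <= rnorm x.
Proof.
rewrite [leRHS]/(Num.sqrt (rnorm x.1 ^+ 2 + rnorm x.2 ^+ 2)).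
by rewrite -{1}(ger0_norm (rnorm_ge0 x.2)) -sqrtr_sqr ler_wsqrtr// lerDr sqr_ge0.
Qed.

Lemma hsum_le (x : hsum V V) : rnorm x <= rnorm x.1 + rnorm x.2.
Proof.
rewrite [leLHS]/(Num.sqrt (rnorm x.1 ^+ 2 + rnorm x.2 ^+ 2)).
rewrite -[leRHS]ger0_norm ?addr_ge0 ?rnorm_ge0// -sqrtr_sqr ler_wsqrtr//.
rewrite sqrrD -addrA lerD2l lerDr mulrn_wge0// mulr_ge0 ?rnorm_ge0//.
Qed.

Definition block_fun (A B C D : bop V) (x : hsum V V) : hsum V V :=
  (A x.1 + B x.2, C x.1 + D x.2).

Lemma block_bounded_linear (A B C D : bop V) :
  block_fun A B C D \in @bounded_linear R (hsum V V).
Proof.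
apply/bounded_linearP; split=> [a u v|].
  by congr (_, _) => /=; rewrite !bop_linear scalerDr addrACA.
have [cA cA0 hA] := bop_bounded A; have [cB cB0 hB] := bop_bounded B.
have [cC cC0 hC] := bop_bounded C; have [cD cD0 hD] := bop_bounded D.
exists ((cA + cB) + (cC + cD)) => x; apply: le_trans (hsum_le _) _.
have h1 := hsum_fst_le x; have h2 := hsum_snd_le x.
rewrite mulrDl; apply: lerD; apply: le_trans (rnormD _ _) _;
  rewrite mulrDl; apply: lerD.
- by apply: le_trans (hA _) _; rewrite ler_wpM2l.
- by apply: le_trans (hB _) _; rewrite ler_wpM2l.
- by apply: le_trans (hC _) _; rewrite ler_wpM2l.
- by apply: le_trans (hD _) _; rewrite ler_wpM2l.
Qed.

(* the operator matrix with rows (A, B) and (C, D) *)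
Definition block_op (A B C D : bop V) : bop (hsum V V) :=
  Bop (block_bounded_linear A B C D).

End BlockOperators.

Section BandMatrices.
Variable R : realType.

(* the sum is over the finite support of the row; infinite support would give
   the default value 0, but only band matrices are used below *)
Definition mxact (A : int -> int -> R) (x : int -> R[i]) (n : int) : R[i] :=
  \sum_(m \in [set: int]) (A n m)%:C * x m.

Definition bounded_band (A : int -> int -> R) : Prop :=
  (forall n m : int, m != n + 1 -> m != n - 1 -> A n m = 0) /\
  exists2 c : R, 0 <= c & forall n m : int, `|A n m| <= c.

Lemma mxactE A x n : bounded_band A ->
  mxact A x n = (A n (n + 1))%:C * x (n + 1) + (A n (n - 1))%:C * x (n - 1).
Proof.
move=> [A0 _]; rewrite /mxact.
rewrite (@fsbigTE _ _ _ _ [fset (n + 1)%R; (n - 1)%R]%fset); last first.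
  move=> m; rewrite !inE negb_or => /andP[m1 m2].
  by rewrite A0// mul0r.
rewrite big_fsetU1/= ?big_seq_fset1// inE.
by apply/eqP; lia.
Qed.

Lemma sqsum_shift (k : int) (x : int -> R[i]) :
  sqsum (fun n => x (n + k)) = sqsum x.
Proof.
rewrite /sqsum [RHS](@reindex_esum _ _ _ [set: int] _ (fun n => n + k))//.
split=> //.
- by move=> u v _ _ /addIr.
- by move=> v _; exists (v - k) => //=; rewrite subrK.
Qed.

Lemma normc_real (a : R) : normc a%:C = `|a|.
Proof. by rewrite /= expr0n/= addr0 sqrtr_sqr. Qed.

Lemma mxact_le A c x : bounded_band A -> 0 <= c -> (forall n m, `|A n m| <= c) ->
  x \in @sqsummable R int -> mxact A x \in @sqsummable R int /\
  fine (sqsum (mxact A x)) <= 4 * c ^+ 2 * fine (sqsum x).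
Proof.
move=> hA c0 Ac sx.
have u0 : 0 <= (1 + 1) * c ^+ 2 by rewrite mulr_ge0 ?sqr_ge0.
have s1 : (fun n => x (n + 1)) \in @sqsummable R int.
  by apply/sqsummableP; rewrite sqsum_shift; exact/sqsummableP.
have s2 : (fun n => x (n - 1)) \in @sqsummable R int.
  by apply/sqsummableP; rewrite sqsum_shift; exact/sqsummableP.
have h n : normc (mxact A x n) ^+ 2 <= (1 + 1) * c ^+ 2 * normc (x (n + 1)) ^+ 2 +
    (1 + 1) * c ^+ 2 * normc (x (n - 1)) ^+ 2.
  rewrite mxactE//; apply: le_trans (normcD_le _ _ ltr01) _.
  rewrite invr1 -!(mulrA (1 + 1)) -!exprMn !normcM !normc_real.
  rewrite lerD// ler_wpM2l// lerXn2r ?nnegrE ?mulr_ge0 ?normc_ge0//.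
  - by rewrite ler_wpM2r ?normc_ge0.
  - by rewrite ler_wpM2r ?normc_ge0.
have [s le] := sqsummable_lin u0 u0 h s1 s2; split=> //.
by move: le; rewrite !sqsum_shift; lra.
Qed.

Lemma mxact_sqsummable A (hA : bounded_band A) (x : ell2 R int) :
  mxact A x \in @sqsummable R int.
Proof.
by have [c c0 Ac] := hA.2; have [] := mxact_le hA c0 Ac (ell2P x).
Qed.

Definition mxfun A (hA : bounded_band A) (x : ell2 R int) : ell2 R int :=
  Ell2 (mxact_sqsummable hA x).

Lemma mxfun_bounded_linear A (hA : bounded_band A) :
  mxfun hA \in @bounded_linear R (ell2 R int).
Proof.
apply/bounded_linearP; split=> [a u v|].
  apply/val_inj/funext => n.
  transitivity (a * mxact A u n + mxact A v n); last by [].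
  transitivity ((A n (n + 1))%:C * (a * u (n + 1) + v (n + 1)) +
                (A n (n - 1))%:C * (a * u (n - 1) + v (n - 1))).
    exact: mxactE.
  by rewrite !mxactE//; ring.
have [c c0 Ac] := hA.2; exists (2 * c) => x.
have [_ le] := mxact_le hA c0 Ac (ell2P x).
rewrite [leLHS]/(ell2norm (mxfun hA x)) [X in _ * X]/(ell2norm x).
suff: ell2norm (mxfun hA x) ^+ 2 <= (2 * c * ell2norm x) ^+ 2.
  by rewrite ler_pXn2r ?nnegrE ?mulr_ge0 ?ell2norm_ge0.
rewrite !exprMn !ell2norm_sqr; apply: le_trans le _.
by rewrite (_ : 2 ^+ 2 = 4 :> R)//; ring.
Qed.

(* the bounded operator on l^2(Z) with bi-infinite matrix A *)
Definition mxop A (hA : bounded_band A) : bop (ell2 R int) :=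
  Bop (mxfun_bounded_linear hA).

End BandMatrices.

Section Euclidean.
Variable R : realType.
Implicit Types u v : 'rV[R]_3.

Definition row3 (x y z : R) : 'rV[R]_3 := \row_(i < 3) nth 0 [:: x; y; z] i.

Definition dot u v : R := \sum_(i < 3) u 0 i * v 0 i.

Definition cross u v : 'rV[R]_3 :=
  let c (w : 'rV[R]_3) k := w 0 (inord k) in
  row3 (c u 1%N * c v 2%N - c u 2%N * c v 1%N)
       (c u 2%N * c v 0%N - c u 0%N * c v 2%N)
       (c u 0%N * c v 1%N - c u 1%N * c v 0%N).

(* Euclidean norm: the library's norm on 'rV[R]_3 is the maximum norm *)
Definition enorm u : R := Num.sqrt (dot u u).

Definition lattice (kx ky kz : R) : set 'rV[R]_3 :=
  [set u | exists l m n : int, u = row3 (kx * l%:~R) (ky * m%:~R) (kz * n%:~R)].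

End Euclidean.

Section ClassOperator.
Variables (R : realType) (p a G : 'rV[R]_3).

Definition atilde_x : R := dot a p / enorm p ^+ 2.
Definition atilde_y : R := enorm (cross a p) / enorm p ^+ 2.

Definition alpha (n : int) : R :=
  Num.sqrt ((atilde_x + n%:~R) ^+ 2 + atilde_y ^+ 2).

Definition cos_theta : R :=
  dot G a * enorm p / (enorm G * enorm (cross p a)).
Definition sin_theta : R :=
  dot G (cross p a) / (enorm G * enorm (cross p a)).

(* row n, column m; the signs follow m = n + 1 and m = n - 1 *)
Definition M1 (n m : int) : R :=
  if m == n + 1 then alpha n / alpha m
  else if m == n - 1 then - (alpha n / alpha m) else 0.

Definition M2 (n m : int) : R :=
  if m == n + 1 then (alpha m ^+ 2 - 1) / alpha m ^+ 2
  else if m == n - 1 then - ((alpha m ^+ 2 - 1) / alpha m ^+ 2) else 0.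

Definition M3 (n m : int) : R :=
  if (m == n + 1) || (m == n - 1) then alpha n / alpha m ^+ 2 else 0.

Lemma alpha_ge0 n : 0 <= alpha n.
Proof. exact: sqrtr_ge0. Qed.

Lemma alphaE n : alpha n = normc ((atilde_x + n%:~R) +i* atilde_y).
Proof. by []. Qed.

Lemma alpha_step n m : m = n + 1 \/ m = n - 1 -> alpha n <= alpha m + 1.
Proof.
move=> nm; rewrite !alphaE.
rewrite (_ : _ +i* _ = ((atilde_x + m%:~R) +i* atilde_y) +
   (n%:~R - m%:~R : R)%:C); last by congr (_ +i* _) => /=; ring.
apply: le_trans (le_normcD _ _) _; rewrite normc_real lerD2l.
rewrite -intrB; case: nm => ->.
  by rewrite (_ : n - (n + 1) = -1); [rewrite normrN1|ring].
by rewrite (_ : n - (n - 1) = 1); [rewrite normr1|ring].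
Qed.

(* since x / 0 = 0, this makes the matrices below bounded with no condition on
   p and a, even if some alpha n vanishes (p and a linearly dependent) *)
Lemma alpha_low : exists2 c : R, 0 < c & forall n, alpha n != 0 -> c <= alpha n.
Proof.
pose k : int := Num.floor atilde_x.
pose e n := if alpha n == 0 then 1 else Num.min 1 (alpha n).
have e0 n : 0 < e n.
  rewrite /e; case: eqP => // /eqP h; rewrite lt_min ltr01.
  by rewrite lt_neqAle eq_sym h alpha_ge0.
exists (Num.min (e (- k)) (e (- k - 1))); first by rewrite lt_min !e0.
move=> n an0.
have [nk|nk] := eqVneq n (- k).
  by rewrite ge_min /e nk -nk (negbTE an0) ge_min lexx orbT.
have [nk1|nk1] := eqVneq n (- k - 1).
  by rewrite ge_min /e -nk1 (negbTE an0) orbC ge_min lexx orbT.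
have le1 : Num.min (e (- k)) (e (- k - 1)) <= 1.
  by rewrite ge_min /e; case: ifP; rewrite ?lexx// ge_min lexx.
apply: le_trans le1 _.
have h : 1 <= `|atilde_x + n%:~R|.
  have := Num.Theory.floor_itv atilde_x; rewrite -/k => /andP[k1 k2].
  have [nk2|nk2] : (- k + 1 <= n) \/ (n <= - k - 2) by lia.
    have : ((- k + 1)%:~R : R) <= n%:~R by rewrite ler_int.
    rewrite intrD intrN => h; rewrite ger0_norm; lra.
  have : (n%:~R : R) <= (- k - 2)%:~R by rewrite ler_int.
  rewrite intrB intrN => h; move: k2; rewrite intrD => k2.
  by rewrite ler0_norm; lra.
apply: le_trans h _; rewrite -sqrtr_sqr ler_wsqrtr// lerDl sqr_ge0//.
Qed.

Lemma alpha_invM c n : 0 < c -> (forall n, alpha n != 0 -> c <= alpha n) ->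
  (alpha n)^-1 <= c^-1.
Proof.
move=> c0 h; have [->|an] := eqVneq (alpha n) 0.
  by rewrite invr0 invr_ge0 ltW.
by rewrite lef_pV2 ?posrE ?h// (lt_le_trans c0)// h.
Qed.

Lemma alpha_ratio c n m : 0 < c -> (forall n, alpha n != 0 -> c <= alpha n) ->
  m = n + 1 \/ m = n - 1 -> alpha n / alpha m <= 1 + c^-1.
Proof.
move=> c0 h nm; have [->|an] := eqVneq (alpha m) 0.
  by rewrite invr0 mulr0 addr_ge0 ?invr_ge0 ?ltW.
apply: le_trans (_ : (alpha m + 1) / alpha m <= _).
  by rewrite ler_wpM2r ?invr_ge0 ?alpha_ge0 ?alpha_step.
by rewrite mulrDl divff// lerD2l mul1r alpha_invM.
Qed.

Lemma M1_band : bounded_band M1.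
Proof.
split; first by move=> n m /negbTE m1 /negbTE m2; rewrite /M1 m1 m2.
have [c c0 h] := alpha_low.
have C0 : 0 <= 1 + c^-1 by rewrite addr_ge0 ?invr_ge0 ?ltW.
exists (1 + c^-1) => // n m; rewrite /M1.
have [m1|_] := eqVneq m (n + 1).
  rewrite ger0_norm ?mulr_ge0 ?invr_ge0 ?alpha_ge0//.
  by apply: alpha_ratio => //; left.
have [m1|_] := eqVneq m (n - 1); last by rewrite normr0.
rewrite normrN ger0_norm ?mulr_ge0 ?invr_ge0 ?alpha_ge0//.
by apply: alpha_ratio => //; right.
Qed.

Lemma M2_band : bounded_band M2.
Proof.
split; first by move=> n m /negbTE m1 /negbTE m2; rewrite /M2 m1 m2.
have [c c0 h] := alpha_low.
have C0 : 0 <= 1 + c^-1 ^+ 2 by rewrite addr_ge0 ?sqr_ge0.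
have key m : `|(alpha m ^+ 2 - 1) / alpha m ^+ 2| <= 1 + c^-1 ^+ 2.
  have [->|am] := eqVneq (alpha m) 0.
    by rewrite expr0n/= invr0 mulr0 normr0.
  rewrite mulrBl divff ?expf_neq0// mul1r.
  apply: le_trans (ler_normB _ _) _; rewrite normr1 lerD2l.
  rewrite -exprVn ger0_norm ?sqr_ge0// lerXn2r ?nnegrE ?invr_ge0 ?alpha_ge0 ?(ltW c0)//.
  exact: alpha_invM.
exists (1 + c^-1 ^+ 2) => // n m; rewrite /M2.
by case: ifP => _ //; case: ifP => _; rewrite ?normrN ?normr0.
Qed.

Lemma M3_band : bounded_band M3.
Proof.
split; first by move=> n m /negbTE m1 /negbTE m2; rewrite /M3 m1 m2.
have [c c0 h] := alpha_low.
have C0 : 0 <= (1 + c^-1) * c^-1.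
  by rewrite mulr_ge0 ?addr_ge0 ?invr_ge0 ?ltW.
exists ((1 + c^-1) * c^-1) => // n m; rewrite /M3.
case: ifP => [nm|_]; last by rewrite normr0.
rewrite ger0_norm; last by rewrite mulr_ge0 ?invr_ge0 ?sqr_ge0 ?alpha_ge0.
rewrite expr2 invfM mulrA ler_pM ?mulr_ge0 ?invr_ge0 ?alpha_ge0//.
  apply: alpha_ratio => //.
  by case/orP: nm => /eqP; [left|right].
exact: alpha_invM.
Qed.

(* the operator M, acting on pairs (y, z) in l^2(Z) + l^2(Z) *)
Definition class_op : bop (hsum (ell2 R int) (ell2 R int)) :=
  sin_theta%:C *: block_op (mxop M1_band) 0 0 (mxop M2_band) +
  cos_theta%:C *: block_op 0 (mxop M3_band) 0 0.

End ClassOperator.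

(* Main.v *)
(** Since p and a are independent, G lies in their span, so it is orthogonal
    to p x a and sin theta = 0. If moreover G were orthogonal to a, it would be
    orthogonal to itself; hence cos theta <> 0. What is left of the operator is
    the strictly upper triangular block cos theta M3, so its square is zero and
    exp (t M) = 1 + t M, which grows linearly in t because M3 <> 0. *)
Require Import Defs.
From mathcomp Require Import all_boot all_order all_algebra.
From mathcomp Require Import finmap complex.
From mathcomp Require Import all_classical all_reals all_analysis.
From mathcomp Require Import ring lra.

Import Order.TTheory GRing.Theory Num.Theory.

Local Open Scope classical_set_scope.
Local Open Scope ring_scope.
Local Open Scope complex_scope.

Section SquareZeroOperators.
Variables (R : realType) (V : normedModType R[i]).
Implicit Types A : bop V.

(** Every term of the exponential series from degree 2 on contains the factor [A ^+ 2], so the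
    partial sums are eventually constant. *)
Lemma opexp_sqr0 A : A ^+ 2 = 0 -> opexp A = 1 + A.
Proof.
move=> A2; apply: cvg_lim; first exact: norm_hausdorff.
apply: cvg_near_cst.
(* The [n]-th partial sum stops at degree [n - 1], so index 2 is the first to contain both [1] and
   [A]. *)
exists 2%N => //= n /= n2; apply/eqP.
rewrite seriesEnat /= (big_cat_nat (n := 2)) //= [X in _ + X]big_nat.
rewrite [X in _ + X]big1 ?addr0; last first.
  by move=> i /andP[i2 _]; rewrite -(subnK i2) exprD A2 mulr0 scaler0.
by rewrite big_nat_recr//= big_nat1 expr0 expr1 !invr1 !scale1r.
Qed.

(** By the triangle inequality, [1 + t%:C *: A] has norm at least [t * rnorm A - rnorm 1], which
    exceeds any bound for large [t]. *)
Lemma opexp_sqr0_unbounded A : A ^+ 2 = 0 -> A != 0 ->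
  ~ bounded_set [set opexp (t%:C *: A) | t in [set t : R | 0 <= t]].
Proof.
move=> A2 A0 /pinfty_ex_gt0 [M M0 bM].
have tA (t : R) : 0 <= t -> opexp (t%:C *: A) = 1 + t%:C *: A.
  move=> t0; apply: opexp_sqr0; apply: bop_ext => x.
  have A2x : A (A x) = 0 by rewrite -[LHS]/((A ^+ 2) x) A2.
  transitivity (t%:C *: A (t%:C *: A x)) => //.
  by rewrite bopZ A2x !scaler0.
(* The bound is an element of [R[i]]; being positive, it is real. *)
have MR : M = (complex.Re M)%:C by rewrite RRe_real// ger0_real// ltW.
have nAp : 0 < rnorm A.
  rewrite lt_neqAle eq_sym rnorm_ge0 andbT.
  by apply: contraNneq A0 => /rnorm_eq0 ->.
(* Chosen so that [t * rnorm A] exceeds [rnorm 1 + complex.Re M] by exactly 1. *)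
pose t := (rnorm (1 : bop V) + complex.Re M + 1) / rnorm A.
have Mp : 0 <= complex.Re M by rewrite -ler0c -MR ltW.
have t0 : 0 <= t by rewrite divr_ge0 ?rnorm_ge0 ?addr_ge0 ?rnorm_ge0.
have : rnorm (1 + t%:C *: A) <= complex.Re M.
  by rewrite -lecR -rnormE -MR -tA//; apply: bM; exists t.
have : rnorm (t%:C *: A) <= rnorm (1 + t%:C *: A) + rnorm (1 : bop V).
  have := rnormD (1 + t%:C *: A) (- 1); rewrite addrC addKr.
  by rewrite /rnorm normrN.
rewrite rnormZ normc_real ger0_norm// /t divfK ?gt_eqF//; lra.
Qed.

End SquareZeroOperators.

Lemma block_upper_sqr0 (R : realType) (V : normedModType R[i]) (B : bop V) :
  block_op 0 B 0 0 ^+ 2 = 0.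
Proof.
apply: bop_ext => x; rewrite expr2.
by congr (_, _); rewrite /= ?addr0 ?bop0 ?addr0.
Qed.

Section EuclideanSpace.
Variable R : realType.
Implicit Types u v w : 'rV[R]_3.

Let i0 : 'I_3 := inord 0.
Let i1 : 'I_3 := inord 1.
Let i2 : 'I_3 := inord 2.

Lemma dotE u v : dot u v = u 0 i0 * v 0 i0 + u 0 i1 * v 0 i1 + u 0 i2 * v 0 i2.
Proof.
rewrite /dot !big_ord_recl big_ord0 addr0 addrA.
by congr (u _ _ * v _ _ + u _ _ * v _ _ + u _ _ * v _ _);
  apply/val_inj; rewrite /= inordK.
Qed.

Lemma dot_crossE u v w : dot u (cross v w) =
  u 0 i0 * (v 0 i1 * w 0 i2 - v 0 i2 * w 0 i1) +
  u 0 i1 * (v 0 i2 * w 0 i0 - v 0 i0 * w 0 i2) +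
  u 0 i2 * (v 0 i0 * w 0 i1 - v 0 i1 * w 0 i0).
Proof. by rewrite dotE !mxE !inordK. Qed.

Lemma dotDr u v w : dot u (v + w) = dot u v + dot u w.
Proof. by rewrite !dotE !mxE; ring. Qed.

Lemma dotZr (c : R) u v : dot u (c *: v) = c * dot u v.
Proof. by rewrite !dotE !mxE; ring. Qed.

Lemma dotC u v : dot u v = dot v u.
Proof. by rewrite !dotE; ring. Qed.

Lemma dot_ge0 u : 0 <= dot u u.
Proof. by rewrite dotE !addr_ge0 -?expr2 ?sqr_ge0. Qed.

Lemma dot_eq0 u : (dot u u == 0) = (u == 0).
Proof.
apply/eqP/eqP => [|->]; last by rewrite dotE !mxE; ring.
move/psumr_eq0P => u0; apply/rowP => i; rewrite mxE; apply/eqP.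
have /eqP := u0 (fun j _ => sqr_ge0 (u 0 j)) i isT.
by rewrite mulf_eq0 orbb.
Qed.

Lemma enorm_eq0 u : (enorm u == 0) = (u == 0).
Proof. by rewrite sqrtr_eq0 -dot_eq0 eq_le dot_ge0 andbT. Qed.

Lemma lagrange u v :
  dot (cross u v) (cross u v) = dot u u * dot v v - dot u v ^+ 2.
Proof. by rewrite !dotE !mxE !inordK//=; ring. Qed.

(** The residue of [u] after orthogonal projection onto [v] has squared length [|u x v|^2 / |v|^2]
    by Lagrange's identity. A zero cross product would therefore put [u] on the line of [v]. *)
Lemma free_cross_neq0 u v : free [:: u; v] -> cross u v != 0.
Proof.
rewrite free_cons span_seq1 => /andP[uv fv].
have v0 : v != 0 by move: fv; rewrite free_cons span_nil memv0 => /andP[].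
apply: contra uv => /eqP c0; apply/vlineP; exists (dot u v / dot v v).
have vv0 : dot v v != 0 by rewrite dot_eq0.
apply/eqP; rewrite -subr_eq0 -dot_eq0.
have -> : dot (u - (dot u v / dot v v) *: v) (u - (dot u v / dot v v) *: v) =
    (dot u u * dot v v - dot u v ^+ 2) / dot v v.
  rewrite -scaleNr !(dotDr, dotZr) ![dot (_ + _) _]dotC.
  rewrite !(dotDr, dotZr) (dotC v u).
  by field.
by rewrite -lagrange c0 mulf_eq0 dot_eq0 eqxx.
Qed.

(** Reconciles [atilde_y], written with [cross a p], with the freeness of [[:: p; a]], which yields
    [cross p a != 0]. *)
Lemma enorm_crossC u v : enorm (cross u v) = enorm (cross v u).
Proof. by rewrite /enorm !lagrange dotC; congr Num.sqrt; ring. Qed.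

End EuclideanSpace.

Section ClassOperator.
Variables (R : realType) (p a G : 'rV[R]_3).
Hypothesis pa_free : free [:: p; a].

Lemma free_neq0l : p != 0.
Proof.
by apply: contraTneq pa_free => p0; rewrite free_cons p0 mem0v.
Qed.

Lemma atilde_y_neq0 : atilde_y p a != 0.
Proof.
rewrite /atilde_y enorm_crossC mulf_neq0 ?invr_eq0 ?expf_neq0 ?enorm_eq0//.
  exact: free_cross_neq0.
exact: free_neq0l.
Qed.

(** The point [(atilde_x + n, atilde_y)] stays off the origin, so the divisions in [M3] are genuine
    ones. *)
Lemma alpha_gt0 n : 0 < alpha p a n.
Proof.
rewrite sqrtr_gt0 ltr_wpDl ?sqr_ge0//.
by rewrite lt_neqAle eq_sym expf_neq0 ?sqr_ge0 ?atilde_y_neq0.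
Qed.

Lemma sqsummable_delta0 :
  (fun n : int => (n == 0)%:R : R[i]) \in @sqsummable R int.
Proof.
apply/sqsummableP; rewrite /sqsum (esumID [set 0]); last first.
  by move=> n _; rewrite lee_fin sqr_ge0.
rewrite [X in (_ + X)%E]esum1 ?adde0; last first.
  by move=> n [_ /= /eqP/negbTE ->]; rewrite Normc.normc0 expr0n.
by rewrite setTI esum_set1 ?ltry// lee_fin sqr_ge0.
Qed.

(** Applied to the unit vector at 0, the operator has at position 1 the matrix entry
    [alpha 1 / alpha 0 ^+ 2], which is positive. *)
Lemma M3_op_neq0 : mxop (M3_band p a) != 0.
Proof.
apply/eqP => /(congr1 (fun B : bop _ => B (Ell2 sqsummable_delta0))) M0.
have : mxact (M3 p a) (fun n : int => (n == 0)%:R) 1 = 0.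
  by have /(congr1 (fun x : ell2 R int => x 1)) := M0.
rewrite mxactE; last exact: M3_band.
(* Row 1 meets columns 2 and 0, and the unit vector keeps only column 0. *)
rewrite subrr eqxx mulr1 mulr0 add0r /M3 subrr eqxx orbT => -[] /eqP.
by rewrite mulf_eq0 invr_eq0 expf_eq0/= !gt_eqF ?alpha_gt0.
Qed.

Hypothesis dep : ~~ free [:: G; p; a].

(** As [p] and [a] are independent, the dependence can only come from [G] lying in their span. *)
Lemma dependent_comb : exists s t, G = s *: p + t *: a.
Proof.
move: dep; rewrite free_cons pa_free andbT negbK span_cons span_seq1.
by move=> /memv_addP[_ /vlineP[s ->] [_ /vlineP[t ->] ->]]; exists s, t.
Qed.

(** The numerator is a triple product of three coplanar vectors. *)
Lemma sin_theta_eq0 : sin_theta p a G = 0.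
Proof.
have [s [t ->]] := dependent_comb; rewrite /sin_theta dot_crossE !mxE.
by rewrite [X in X / _](_ : _ = 0) ?mul0r//; ring.
Qed.

Lemma cos_theta_neq0 : G != 0 -> dot p G = 0 -> cos_theta p a G != 0.
Proof.
move=> G0 pG; have Ga : dot G a != 0.
  apply: contra G0 => /eqP Ga; have [s [t Gst]] := dependent_comb.
  (* Expanding only the second factor of [dot G G] leaves multiples of [dot G p] and [dot G a], both
     zero. *)
  by rewrite -dot_eq0 {2}Gst dotDr !dotZr dotC pG Ga !mulr0 addr0.
by rewrite !(mulf_neq0, invr_neq0)// enorm_eq0 ?free_neq0l ?free_cross_neq0.
Qed.

End ClassOperator.

Theorem theorem5p1 (R : realType) (kx ky kz : R)
    (hkx : 0 < kx) (hky : 0 < ky) (hkz : 0 < kz)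
    (p a G : 'rV[R]_3)
    (hp : p \in lattice kx ky kz) (ha : a \in lattice kx ky kz)
    (hpa : free [:: p; a])
    (hG : G != 0) (hpG : dot p G = 0)
    (hdep : ~~ free [:: G; p; a]) :
  nilpotent_op (class_op p a G) /\
  ~ bounded_set [set opexp (t%:C *: class_op p a G) | t in [set t : R | 0 <= t]].
Proof.
have opE : class_op p a G =
    block_op 0 ((cos_theta p a G)%:C *: mxop (M3_band p a)) 0 0.
  rewrite /class_op (sin_theta_eq0 _ _ _ _ hpa hdep)// scale0r add0r.
  by apply: bop_ext => x; congr (_, _); rewrite /= ?add0r ?addr0 ?scaler0.
have op2 : class_op p a G ^+ 2 = 0 by rewrite opE block_upper_sqr0.
split; first by exists 2%N.
apply: opexp_sqr0_unbounded => //; rewrite opE.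
(* If the block operator vanished, its values on the pairs [(0, x)] would force [cos_theta] times
   the [M3] operator to be zero, and the nonzero scalar cancels. *)
have := M3_op_neq0 _ _ _ hpa; apply: contra => /eqP B0.
have := cos_theta_neq0 _ _ _ _ hpa hdep hG hpG => cos0.
have cos0C : (cos_theta p a G)%:C != 0 by apply: contraNneq cos0 => -[->].
apply/eqP; apply: (scalerI cos0C); rewrite scaler0; apply: bop_ext => x.
have /(congr1 (fun B : bop (hsum (ell2 R int) (ell2 R int)) =>
  (B (0, x)).1)) := B0.
by rewrite /= add0r.
Qed.
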